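(* Let $n\geq 1$ be an integer and $\sigma>0$, and suppose $Z\sim\mathrm{PN}(n,\sigma^2)$. Let $f\in C^n(\mathbb{R})$ be such that $\mathbb{E}|Zf(Z)|<\infty$ and $\mathbb{E}|Z^{k-1}f^{(k)}(Z)|<\infty$ for $k=1,\ldots,n$. Then $$\mathbb{E}[\sigma^2A_nf(Z)-Zf(Z)]=0.$$
   Context: $\mathrm{PN}(n,\sigma^2)$ (the product normal distribution) is the distribution of $X_1X_2\cdots X_n$, where $X_1,\ldots,X_n$ are independent with $X_i\sim N(0,\sigma_i^2)$, $\sigma_i>0$, and $\sigma=\sigma_1\sigma_2\cdots\sigma_n$. $T$ denotes the operator $Tf(x)=xf'(x)$, and $A_nf(x)=x^{-1}T^nf(x)=\frac{\mathrm{d}}{\mathrm{d}x}\big(T^{n-1}f(x)\big)$; equivalently $A_nf(x)=\sum_{k=1}^n{n\brace k}x^{k-1}f^{(k)}(x)$, where ${n\brace k}$ are Stirling numbers of the second kind. $C^n(\mathbb{R})$ denotes the $n$ times continuously differentiable functions on $\mathbb{R}$. *)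

(* Defs.v *)
From HB Require Import structures.
From mathcomp Require Import all_boot all_order all_algebra.
From mathcomp Require Import all_classical all_reals all_analysis.
Import Order.TTheory GRing.Theory Num.Theory.
Import numFieldNormedType.Exports.

Set Implicit Arguments.
Unset Strict Implicit.
Unset Printing Implicit Defensive.

Local Open Scope classical_set_scope.
Local Open Scope ring_scope.

(* Product rule for every subfamily J of the index set. *)
Definition mutually_independent (R : realType) (d : measure_display)
    (T : measurableType d) (P : probability T R) (n : nat)
    (X : 'I_n -> {RV P >-> R}) : Prop :=
  forall (J : {set 'I_n}) (B : 'I_n -> set R),
    (forall i, i \in J -> measurable (B i)) ->
    P (\bigcap_(i in [set j | j \in J]) (X i @^-1` B i)) =
    (\prod_(i in J) P (X i @^-1` B i))%E.

(* The law mu is PN(n, sigma^2).  The second argument of normal_prob is the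
   standard deviation. *)
Definition product_normal (R : realType) (n : nat) (sigma : R)
    (mu : set R -> \bar R) : Prop :=
  exists (d : measure_display) (T : measurableType d) (P : probability T R)
         (X : 'I_n -> {RV P >-> R}) (s : 'I_n -> R),
    [/\ mutually_independent X,
        forall i, 0 < s i,
        forall i (B : set R), measurable B ->
          distribution P (X i) B = normal_prob 0 (s i) B,
        sigma = \prod_(i < n) s i
      & forall B : set R, measurable B ->
          mu B = P ((fun w => \prod_(i < n) X i w) @^-1` B)].

Definition T_op (R : realType) (f : R -> R) : R -> R :=
  fun x => x * derive1 f x.

(* The form d/dx (T^(n-1) f) makes sense at x = 0, unlike x^-1 T^n f(x). *)
Definition A_op (R : realType) (n : nat) (f : R -> R) : R -> R :=
  derive1 (iter n.-1 (@T_op R) f).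

(* f is n times continuously differentiable on R.  Since derive1n is total,
   differentiability at each order below n has to be required. *)
Definition Cn (R : realType) (n : nat) (f : R -> R) : Prop :=
  (forall (k : nat) (x : R), (k < n)%N -> derivable (derive1n k f) x 1) /\
  continuous (derive1n n f).

(* Main.v *)
Require Import Defs.
From mathcomp Require Import all_boot all_order all_algebra.
From mathcomp Require Import all_classical all_reals all_analysis.
From mathcomp Require Import measurable_realfun ring.
Import Order.TTheory GRing.Theory Num.Theory.
Import numFieldNormedType.Exports.

Local Open Scope classical_set_scope.
Local Open Scope ring_scope.

Set Implicit Arguments.
Unset Strict Implicit.
Unset Printing Implicit Defensive.

(** For n = 1 the identity is the Gaussian integration by parts
    E[X (g(X) - g(0))] = s^2 E[g'(X)].  Writing g(x) - g(0) as the integral of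
    x g'(u x) over u in ]0, 1], it reads

      E[X^2 (H q)(X)] = s^2 E[q(X)],   (H q)(y) = integral of q(u y) over ]0, 1],

    with q = g'.  In this form it makes sense, and is true by Tonelli's theorem,
    for every nonnegative measurable q ([normal_zero_bias]).

    The averaging operator H commutes with dilations, so such identities multiply:
    conditioning on one factor of a product of independent variables turns the
    other factor into a dilation ([zero_biasM]).  Hence Z ~ PN(n, sigma^2)
    satisfies E[Z^2 (H^n q)(Z)] = sigma^2 E[q(Z)] ([product_normal_bias]).

    The operator A_n is built to be undone by H^n.  Since y H(g')(y) is
    g(y) - g(0), taking g = T^k f = x A_k f, which vanishes at 0 for k >= 1, gives
    H A_{k+1} f = A_k f away from 0, and g = f gives
    H A_1 f (y) = (f(y) - f(0)) / y.  Therefore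
    y^2 (H^n A_n f)(y) = y (f(y) - f(0)) ([sqr_iter_hardy_A_op]).

    As A_n f is a combination of the functions x^(k-1) f^(k) with Stirling
    numbers as coefficients ([A_opE]), A_n f(Z) is integrable.  Applying the
    identity to the positive and negative parts of A_n f and subtracting gives
    E[Z (f(Z) - f(0))] = sigma^2 E[A_n f(Z)], the integrability of the left-hand
    side being part of the conclusion.  Finally E[Z] = 0, because the law of Z is
    symmetric, and has a second moment by the case q = 1. *)

(** * Integration against dilated measures and densities *)

Lemma scale_preimage_itvoc (R : realType) (c a b : R) : c != 0 ->
  lebesgue_measure ( *%R c @^-1` `]a, b]%classic) =
  (`|c|^-1%:E * lebesgue_measure `]a, b]%classic)%E.
Proof.
move=> c0; have [cgt|clt|/eqP] := ltgtP 0 c; last by rewrite eq_sym (negPf c0).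
- rewrite (_ : _ @^-1` _ = `](c^-1 * a), (c^-1 * b)]%classic); last first.
    by apply/seteqP; split => x /=; rewrite !in_itv/= ltr_pdivrMl// ler_pdivlMl.
  rewrite !lebesgue_measure_itv/= !lte_fin ltr_pM2l ?invr_gt0// gtr0_norm//.
  by case: ifP => _; rewrite ?mule0// -!EFinB -EFinM mulrBr.
- rewrite (_ : _ @^-1` _ = `[(c^-1 * b), (c^-1 * a)[%classic); last first.
    apply/seteqP; split => x /=;
      by rewrite !in_itv/= ltr_ndivlMl// ler_ndivrMl// andbC.
  rewrite !lebesgue_measure_itv/= !lte_fin ltr_nM2l ?invr_lt0// ltr0_norm//.
  by case: ifP => _; rewrite ?mule0// -!EFinB -EFinM invrN mulNr mulrBr opprB.
Qed.

(** Two measures that agree on half-open intervals are equal, so the image of the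
    Lebesgue measure under multiplication by [c] is a multiple of it. *)
Lemma ge0_integral_scale (R : realType) (c : R) (q : R -> \bar R) : c != 0 ->
  measurable_fun [set: R] q -> (forall x, 0 <= q x)%E ->
  (\int[lebesgue_measure]_x q (c * x)%R =
   `|c|^-1%:E * \int[lebesgue_measure]_x q x)%E.
Proof.
move=> c0 mq q0.
have mc : measurable_fun [set: measurableTypeR R]
  ( *%R c : measurableTypeR R -> measurableTypeR R) by exact: mulrl_measurable.
have cV0 : 0 <= `|c| by [].
rewrite [in RHS](eq_measure_integral (mscale (NngNum cV0)
    (pushforward lebesgue_measure
      ( *%R c : measurableTypeR R -> measurableTypeR R)))); last first.
  move=> A mA _; apply: lebesgue_measure_unique => //= _ [[a b]] _ <-.
  rewrite [RHS](_ : _ = `|c|%:E *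
    lebesgue_measure ( *%R c @^-1` `]a, b]%classic))%E//.
  by rewrite scale_preimage_itvoc// muleA -EFinM divff ?normr_eq0// mul1e.
rewrite ge0_integral_mscale// ge0_integral_pushforward//=.
by rewrite muleA -EFinM mulVf ?normr_eq0// mul1e.
Qed.

Section density.
Context d (T : measurableType d) (R : realType).
Variables (m1 m : {measure set T -> \bar R}) (p : T -> R).
Hypotheses (mp : measurable_fun setT p) (p0 : forall x, 0 <= p x).
Hypothesis m1E : forall A, measurable A ->
  m1 A = (\int[m]_(x in A) (p x)%:E)%E.
Local Open Scope ereal_scope.
Import HBNNSimple.

Let integral_density_nnsfun (g : {nnsfun T >-> R}) :
  \int[m1]_x (g x)%:E = \int[m]_x ((g x)%:E * (p x)%:E).
Proof.
under [LHS]eq_integral do rewrite fimfunE -fsumEFin//.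
rewrite [LHS]ge0_integral_fsum//; last 2 first.
  - by move=> r; exact/measurable_EFinP/measurableT_comp.
  - by move=> n x _; rewrite EFinM nnfun_muleindic_ge0.
under [RHS]eq_integral.
  move=> x xD; rewrite fimfunE -fsumEFin// ge0_mule_fsuml; last first.
    by move=> r; rewrite EFinM nnfun_muleindic_ge0.
  over.
rewrite [RHS]ge0_integral_fsum//; last 2 first.
  - move=> r; apply: emeasurable_funM; last exact/measurable_EFinP.
    exact/measurable_EFinP/measurableT_comp.
  - by move=> n x _; rewrite mule_ge0 ?lee_fin//= -lee_fin EFinM nnfun_muleindic_ge0.
apply: eq_fsbigr => r _.
have [r0|r0] := leP 0%R r; last first.
  rewrite !integral0_eq// => x _; rewrite preimage_nnfun0// indic0 mulr0//.
  by rewrite mul0e.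
rewrite (eq_integral (fun x => r%:E * (\1_(g @^-1` [set r]) x)%:E)); last first.
  by move=> x _; rewrite EFinM.
rewrite ge0_integralZl//; last first.
  exact/measurable_EFinP/measurable_indic.
rewrite integral_indic// setIT m1E// integral_mkcond.
under [in RHS]eq_integral do rewrite EFinM -muleA.
rewrite ge0_integralZl//; last 2 first.
- apply: emeasurable_funM; last exact/measurable_EFinP.
  exact/measurable_EFinP/measurable_indic.
- by move=> x _; rewrite mule_ge0// lee_fin.
congr (_ * _); apply: eq_integral => x _.
by rewrite epatch_indic muleC.
Qed.

Lemma ge0_integral_density (f : T -> \bar R) :
  measurable_fun setT f -> (forall x, 0 <= f x) ->
  \int[m1]_x f x = \int[m]_x (f x * (p x)%:E).
Proof.
move=> mf f0; pose f_ := nnsfun_approx measurableT mf.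
transitivity (limn (fun n => \int[m1]_x (f_ n x)%:E)).
  rewrite -monotone_convergence//=.
  - apply: eq_integral => ? /[!inE] xD; apply/esym/cvg_lim => //=.
    exact: cvg_nnsfun_approx.
  - by move=> n; exact/measurable_EFinP/measurable_funTS.
  - by move=> n ? _; rewrite lee_fin.
  - by move=> ? _ ? ? mn; rewrite lee_fin; exact/lefP/nd_nnsfun_approx.
transitivity (limn (fun n => \int[m]_x ((f_ n x)%:E * (p x)%:E))).
  by apply: congr_lim; apply/funext => n; exact: integral_density_nnsfun.
rewrite -monotone_convergence//=.
- apply: eq_integral => x _; apply/cvg_lim => //=.
  by apply: cvgeZr => //; exact: cvg_nnsfun_approx.
- move=> n; apply: emeasurable_funM; last exact/measurable_EFinP.
  exact/measurable_EFinP/measurable_funTS.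
- by move=> n ? _; rewrite mule_ge0// lee_fin.
- move=> x _ a b ab; rewrite lee_wpmul2r ?lee_fin//.
  exact/lefP/nd_nnsfun_approx.
Qed.

End density.

(** * The averaging operator *)

(** The Hardy averaging operator, i.e. the mean of [q] between 0 and [y]; the form
    with [u * y] makes commutation with dilations immediate. *)
Definition hardy (R : realType) (q : R -> \bar R) (y : R) : \bar R :=
  (\int[lebesgue_measure]_(u in `]0%R, 1%R]) q (u * y)%R)%E.

Lemma hardy_ge0 (R : realType) (q : R -> \bar R) (y : R) :
  (forall x, 0 <= q x)%E -> (0 <= hardy q y)%E.
Proof. by move=> q0; apply: integral_ge0 => u _. Qed.

Lemma measurable_fst_mul_snd (R : realType) :
  measurable_fun [set: R * R] (fun z : R * R => z.1 * z.2).
Proof. by apply: measurable_funM; [exact: measurable_fst|exact: measurable_snd]. Qed.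

Lemma measurable_hardy (R : realType) (q : R -> \bar R) :
  measurable_fun [set: R] q -> (forall x, 0 <= q x)%E ->
  measurable_fun [set: R] (hardy q).
Proof.
move=> mq q0.
pose f (z : R * R) := (q (z.1 * z.2)%R * (\1_(`]0%R, 1%R]%classic) z.2)%:E)%E.
have mf : measurable_fun [set: R * R] f.
  apply: emeasurable_funM; first by apply: (measurableT_comp mq); exact: measurable_fst_mul_snd.
  apply/measurable_EFinP; apply: (measurableT_comp _ measurable_snd).
  exact: measurable_indic.
have f0 z : (0 <= f z)%E by rewrite mule_ge0// lee_fin.
rewrite [X in measurable_fun _ X](_ : _ =
  fubini_F (@lebesgue_measure R) f).
  exact: measurable_fun_fubini_tonelli_F.
apply/funext => y; rewrite /hardy /fubini_F [LHS]integral_mkcond.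
by apply: eq_integral => u _; rewrite epatch_indic /f/= mulrC.
Qed.

(** The pairs (y, t) with t between 0 and y (t nonzero), that is 0 < t / y <= 1.
    The inequality is multiplied by y^2 so that the set is visibly measurable. *)
Definition shadow (R : realType) : set (R * R) :=
  [set z | 0 < z.1 * z.2 <= z.1 ^+ 2].

Lemma measurable_shadow (R : realType) : measurable (@shadow R).
Proof.
have mM := @measurable_fst_mul_snd R.
have mX : measurable_fun [set: R * R] (fun z : R * R => z.1 ^+ 2).
  by apply: measurable_funX; exact: measurable_fst.
rewrite (_ : @shadow R =
  (setT `&` (fun z => 0 < z.1 * z.2 <= z.1 ^+ 2) @^-1` [set true])).
  by apply: measurable_and => //; [exact: measurable_fun_ltr|exact: measurable_fun_ler].
by apply/seteqP; split => z /=; [move=> -> //|case].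
Qed.

Lemma measurable_indic_shadow (R : realType) :
  measurable_fun [set: R * R] (\1_(@shadow R) : R * R -> R).
Proof. exact: (@measurable_indic _ _ R _ _ (@measurable_shadow R)). Qed.
Arguments measurable_indic_shadow : clear implicits.

Lemma indic_shadowE (R : realType) (y t : R) :
  \1_(@shadow R) (y, t) = ((0 < y * t <= y ^+ 2)%R%:R : R).
Proof. rewrite indicE; congr ((nat_of_bool _)%:R); apply/idP/idP.
  by move=> /set_mem.
by move=> H; apply/mem_set. Qed.

Lemma indic_shadow_scale (R : realType) (y u : R) : y != 0 ->
  \1_(@shadow R) (y, y * u) = \1_(`]0, 1]%classic) u :> R.
Proof.
move=> y0; have y2 : 0 < y ^+ 2 by rewrite exprn_even_gt0.
rewrite indic_shadowE indicE; congr ((nat_of_bool _)%:R).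
rewrite mem_setE in_itv/= mulrA -expr2 pmulr_rgt0//.
by rewrite -[X in _ <= X]mulr1 ler_pM2l.
Qed.

(** The substitution t = u y turns the average of [q] over the segment from 0 to [y]
    into an integral over the whole line, ready for an exchange of integrals. *)
Lemma hardy_shadow (R : realType) (q : R -> \bar R) (y : R) : y != 0 ->
  measurable_fun [set: R] q -> (forall x, 0 <= q x)%E ->
  (`|y|%:E * hardy q y =
   \int[lebesgue_measure]_t (q t * (\1_(@shadow R) (y, t))%:E))%E.
Proof.
move=> y0 mq q0.
have mg : measurable_fun [set: R] (fun t => q t * (\1_(@shadow R) (y, t))%:E)%E.
  apply: emeasurable_funM => //; apply/measurable_EFinP.
  exact: (measurable_fun_pair2 y (measurable_indic_shadow R)).
have g0 t : (0 <= q t * (\1_(@shadow R) (y, t))%:E)%E.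
  by rewrite mule_ge0// lee_fin.
rewrite /hardy integral_mkcond.
transitivity (`|y|%:E * \int[lebesgue_measure]_u
    (q (y * u)%R * (\1_(@shadow R) (y, (y * u)%R))%:E))%E.
  congr (_ * _)%E; apply: eq_integral => u _.
  by rewrite epatch_indic indic_shadow_scale// mulrC.
rewrite (ge0_integral_scale y0 mg g0) muleA -EFinM divff ?normr_eq0//.
by rewrite mul1e.
Qed.

(** * The integrated Stein identity for a normal law *)

Section normal_tail.
Context (R : realType) (s : R).
Hypothesis s0 : s != 0.
Local Notation phi := (normal_pdf 0 s).

(** The differential equation phi' = - x phi / s^2 of the normal density, which is
    the source of the factor s^2 in Stein's identity. *)
Lemma is_derive_normal_pdf (x : R) :
  is_derive x 1 (fun x => - (s ^+ 2 * phi x)) (x * phi x).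
Proof.
rewrite !normal_pdfE// /normal_fun.
have dg : is_derive x 1 (fun x : R => - (x - 0) ^+ 2 / (s ^+ 2 *+ 2))
    (- x / s ^+ 2).
  apply: is_derive_eq; rewrite scaler0 add0r !subr0 -[_ *: _]/(_ * _).
  by rewrite -[_ *: _]/(_ * _) mulr1 -mulr2n; field.
have de : is_derive x 1 (fun x : R => expR (- (x - 0) ^+ 2 / (s ^+ 2 *+ 2)))
    (- x / s ^+ 2 * expR (- (x - 0) ^+ 2 / (s ^+ 2 *+ 2))).
  by have := is_derive1_comp (is_derive_expR _) dg; rewrite /= mulrC.
apply: is_derive_eq; move: (expR _) (normal_peak s) => e p.
rewrite -[LHS]/(- (s ^+ 2 * (p * (- x / s ^+ 2 * e)))).
by field.
Qed.

Lemma cvg_normal_pdf : phi x @[x --> +oo] --> 0.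
Proof.
rewrite normal_pdfE// /normal_fun.
rewrite [X in _ --> X](_ : 0 = normal_peak s * 0); last by rewrite mulr0.
apply: cvgM; first exact: cvg_cst.
have -> : (fun x => expR (- (x - 0) ^+ 2 / (s ^+ 2 *+ 2))) =
   (fun x => expR (- x)) \o (fun x : R => x ^+ 2) \o
   (fun x : R => x * (Num.sqrt (s ^+ 2 *+ 2))^-1).
  apply/funext => x /=; congr expR; rewrite subr0 exprMn exprVn sqr_sqrtr ?mulNr//.
  by rewrite mulrn_wge0// sqr_ge0.
apply: (cvg_comp _ (fun x => expR (- x))); last exact: cvgr_expR.
apply: (cvg_comp _ (fun x => x ^+ 2)); last exact: cvgr_expr2.
apply/gt0_cvgMly; last exact: cvg_id.
by rewrite invr_gt0 sqrtr_gt0 mulrn_wgt0// exprn_even_gt0.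
Qed.

Lemma normal_tail_gt0 (t : R) : 0 < t ->
  (\int[lebesgue_measure]_y ((`|y| * phi y)%:E * (\1_(@shadow R) (y, t))%:E) =
   (s ^+ 2 * phi t)%:E)%E.
Proof.
move=> t0.
transitivity (\int[lebesgue_measure]_(y in `[t, +oo[) (y * phi y)%:E)%E.
  rewrite [RHS]integral_mkcond; apply: eq_integral => y _.
  rewrite patchE indic_shadowE mem_setE in_itv/= andbT.
  have [ty|yt] := leP t y.
    have y0 : 0 < y by apply: lt_le_trans ty.
    by rewrite mulr_gt0//= expr2 ler_pM2l// ty mule1 gtr0_norm.
  rewrite (_ : _ && _ = false) ?mule0//; apply/negbTE/negP => /andP[].
  rewrite pmulr_lgt0// => y0.
  by rewrite expr2 ler_pM2l// leNgt yt.
have dF y := is_derive_normal_pdf y.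
(* By is_derive_normal_pdf, - s^2 phi is a primitive of y phi(y) that tends to 0
   at infinity. *)
rewrite (@ge0_continuous_FTC2y _ _ (fun x => - (s ^+ 2 * phi x)) _ 0).
- by rewrite sub0e EFinN oppeK.
- by move=> y ty; rewrite mulr_ge0 ?normal_pdf_ge0// (le_trans _ ty)// ltW.
- apply: continuous_subspaceT => y; apply: cvgM; first exact: cvg_id.
  exact: continuous_normal_pdf.
- rewrite [X in _ --> X](_ : 0 = - (s ^+ 2 * 0)); last by rewrite mulr0 oppr0.
  apply: cvgN; apply: cvgM; first exact: cvg_cst.
  exact: cvg_normal_pdf.
- by move=> y _; have [] := dF y.
- apply: cvg_at_right_filter; apply: cvgN; apply: cvgM; first exact: cvg_cst.
  exact: continuous_normal_pdf.
- by move=> y _; rewrite derive1E; apply: derive_val.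
Qed.

Lemma normal_pdfN (t : R) : phi (- t) = phi t.
Proof. by rewrite normal_pdfE// /normal_fun !subr0 sqrrN. Qed.

(** For fixed t, the y whose segment from 0 contains t form the half-line starting
    at t and going away from 0; both signs of t reduce to the integral of y phi(y)
    over [t, +oo[ since phi is even. *)
Lemma normal_tail (t : R) : t != 0 ->
  (\int[lebesgue_measure]_y ((`|y| * phi y)%:E * (\1_(@shadow R) (y, t))%:E) =
   (s ^+ 2 * phi t)%:E)%E.
Proof.
move=> t0; have [tp|tn|/eqP] := ltgtP 0 t; last by rewrite eq_sym (negPf t0).
  exact: normal_tail_gt0.
rewrite -(normal_pdfN t) -normal_tail_gt0 ?oppr_gt0//.
have mg : measurable_fun [set: R]
    (fun y => (`|y| * phi y)%:E * (\1_(@shadow R) (y, t))%:E)%E.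
  apply: emeasurable_funM; apply/measurable_EFinP.
    apply: measurable_funM; last exact: measurable_normal_pdf.
    exact: normr_measurable.
  exact: (measurable_fun_pair1 t (measurable_indic_shadow R)).
have g0 y : (0 <= (`|y| * phi y)%:E * (\1_(@shadow R) (y, t))%:E)%E.
  by rewrite mule_ge0// lee_fin// mulr_ge0// normal_pdf_ge0.
have N10 : -1 != 0 :> R by rewrite oppr_eq0 oner_eq0.
have := ge0_integral_scale N10 mg g0.
rewrite normrN1 invr1 mul1e => <-.
apply: eq_integral => y _.
by rewrite mulN1r normrN normal_pdfN !indic_shadowE mulNr mulrN sqrrN.
Qed.
End normal_tail.

(** For X of law [m] and U_1, ..., U_k independent uniform variables on ]0, 1],
    this is E[X^2 q(U_1 ... U_k X)] = c E[q(X)]: for k = 1 and c = E[X^2] it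
    states that X has its own zero-bias distribution, which is Stein's
    characterization of N(0, c).  Quantifying over nonnegative functions with
    values in the extended reals frees it from integrability conditions. *)
Definition zero_bias (R : realType) (m : set R -> \bar R)
    (k : nat) (c : R) : Prop :=
  forall q : R -> \bar R,
    measurable_fun [set: R] q -> (forall x, 0 <= q x)%E ->
    (\int[m]_z ((z ^+ 2)%:E * iter k (@hardy R) q z) =
     c%:E * \int[m]_z q z)%E.

(** The Borel sets of [R] and those of [measurableTypeR R] are the same, but they are
    attached to distinct displays, so that the two integrals are not convertible;
    the image under the identity transfers one to the other. *)
Lemma ge0_integral_measurableTypeR (R : realType)
    (m : {measure set (measurableTypeR R) -> \bar R}) (f : R -> \bar R) :
  measurable_fun [set: R] f -> (forall x, 0 <= f x)%E ->
  (\int[m : set R -> \bar R]_x f x = \int[m]_x f x)%E.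
Proof.
move=> mf f0.
have mid : measurable_fun [set: measurableTypeR R] (id : measurableTypeR R -> R).
  by [].
exact: (@ge0_integral_pushforward _ _ (measurableTypeR R) R R _ mid m setT f
  measurableT mf (fun x _ => f0 x)).
Qed.

Lemma ge0_integral_normal (R : realType) (s : R) (f : R -> \bar R) :
  measurable_fun [set: R] f -> (forall x, 0 <= f x)%E ->
  (\int[normal_prob 0 s : set R -> \bar R]_x f x =
   \int[lebesgue_measure]_x (f x * (normal_pdf 0 s x)%:E))%E.
Proof.
move=> mf f0; rewrite ge0_integral_measurableTypeR//.
exact: (@ge0_integral_density _ (measurableTypeR R) R (normal_prob 0 s)
  lebesgue_measure _ (measurable_normal_pdf 0 s) (normal_pdf_ge0 0 s)
  (fun _ _ => erefl) f).
Qed.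

(** By [hardy_shadow], y^2 (H q)(y) is the integral of |y| q(t) over the t between 0
    and y; exchanging the two integrals leaves [normal_tail]. *)
Lemma normal_zero_bias (R : realType) (s : R) : s != 0 ->
  zero_bias (normal_prob 0 s) 1 (s ^+ 2).
Proof.
move=> s0 q mq q0 /=.
have mphi := @measurable_normal_pdf R 0 s.
have phi0 := @normal_pdf_ge0 R 0 s.
have mh := measurable_hardy mq q0.
have mX : measurable_fun [set: R] (fun y : R => (y ^+ 2)%:E).
  exact/measurable_EFinP/measurable_funX.
rewrite ge0_integral_normal; last 2 first.
- exact: emeasurable_funM.
- by move=> y; rewrite mule_ge0 ?hardy_ge0// lee_fin sqr_ge0.
pose w (y : R) : \bar R := (`|y| * normal_pdf 0 s y)%:E.
have mw : measurable_fun [set: R] w.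
  by apply/measurable_EFinP; apply: measurable_funM => //; exact: normr_measurable.
have w0 y : (0 <= w y)%E by rewrite lee_fin mulr_ge0.
pose F (z : R * R) := (w z.1 * (\1_(@shadow R) z)%:E * q z.2)%E.
have mF : measurable_fun [set: R * R] F.
  apply: emeasurable_funM; last by apply: (measurableT_comp mq); exact: measurable_snd.
  apply: emeasurable_funM; last first.
    by apply/measurable_EFinP; exact: (measurable_indic_shadow R).
  by apply: (measurableT_comp mw); exact: measurable_fst.
have F0 z : (0 <= F z)%E by rewrite mule_ge0// mule_ge0// lee_fin.
transitivity (\int[lebesgue_measure]_y \int[lebesgue_measure]_t F (y, t))%E.
  apply: eq_integral => y _; rewrite /F /w/=.
  have [->|y0] := eqVneq y 0.
    rewrite expr0n/= !mul0e normr0 mul0r integral0_eq// => t _.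
    by rewrite !mul0e.
  under [RHS]eq_integral do rewrite -muleA [((\1_ _ _)%:E * _)%E]muleC.
  rewrite ge0_integralZl//; last 3 first.
  - apply: emeasurable_funM => //; apply/measurable_EFinP.
    exact: (measurable_fun_pair2 y (measurable_indic_shadow R)).
  - by move=> t _; rewrite mule_ge0// lee_fin.
  - exact: w0.
  rewrite -hardy_shadow// muleA -EFinM muleC muleA -EFinM; congr (_%:E * _)%E.
  by rewrite mulrAC -expr2 real_normK ?num_real// mulrC.
rewrite (@fubini_tonelli _ _ (measurableTypeR R) (measurableTypeR R) R
  lebesgue_measure lebesgue_measure F mF F0).
transitivity (\int[lebesgue_measure]_t
    ((s ^+ 2)%:E * (q t * (normal_pdf 0 s t)%:E)))%E.
  (* At t = 0 the inner integral is 0 instead of s^2 phi(0); this point is null. *)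
  rewrite -(@integral_setD1 _ _ 0 setT); last 2 first.
  - exact: measurableD.
  - apply: measurable_funTS.
    exact: (@measurable_fun_fubini_tonelli_G _ _ (measurableTypeR R)
      (measurableTypeR R) R lebesgue_measure F mF F0).
  rewrite -[RHS](@integral_setD1 _ _ 0 setT); last 2 first.
  - exact: measurableD.
  - apply: measurable_funTS; apply: emeasurable_funM => //.
    by apply: emeasurable_funM => //; exact/measurable_EFinP.
  apply: eq_integral => t /set_mem [_ /= /eqP t0].
  rewrite /F/= ge0_integralZr//; last 2 first.
  - apply: emeasurable_funM => //; apply/measurable_EFinP.
    exact: (measurable_fun_pair1 t (measurable_indic_shadow R)).
  - by move=> y _; rewrite mule_ge0// lee_fin.
  by rewrite normal_tail// EFinM -muleA [(_%:E * q t)%E]muleC.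
rewrite ge0_integralZl//; last 3 first.
- by apply: emeasurable_funM => //; exact/measurable_EFinP.
- by move=> t _; rewrite mule_ge0// lee_fin.
- by rewrite lee_fin sqr_ge0.
by rewrite -ge0_integral_normal.
Qed.

(** * Products of independent factors *)

Lemma iter_hardy_ge0 (R : realType) (k : nat) (q : R -> \bar R) (y : R) :
  (forall x, 0 <= q x)%E -> (0 <= iter k (@hardy R) q y)%E.
Proof.
by move=> q0; elim: k y => [|k IH] y /=; [exact: q0|exact: hardy_ge0].
Qed.

Lemma measurable_iter_hardy (R : realType) (k : nat) (q : R -> \bar R) :
  measurable_fun [set: R] q -> (forall x, 0 <= q x)%E ->
  measurable_fun [set: R] (iter k (@hardy R) q).
Proof.
move=> mq q0; elim: k => [//|k IH] /=.
by apply: measurable_hardy => // y; exact: iter_hardy_ge0.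
Qed.

Lemma iter_hardy_scale (R : realType) (k : nat) (q : R -> \bar R) (x y : R) :
  iter k (@hardy R) (fun z => q (z * y)%R) x = iter k (@hardy R) q (x * y).
Proof.
elim: k x => [//|k IH] x /=.
by apply: eq_integral => u _; rewrite IH mulrA.
Qed.

Section product_of_independent.
Context d (T : measurableType d) (R : realType) (P : probability T R).
Variables (X Y : {mfun T >-> R}).
Hypothesis XY : forall A B : set R, measurable A -> measurable B ->
  P (X @^-1` A `&` Y @^-1` B) = (P (X @^-1` A) * P (Y @^-1` B))%E.
Local Notation mX := (distribution P X).
Local Notation mY := (distribution P Y).
Local Notation mXY := (distribution P (X * Y)).

Lemma ge0_integral_distributionM (f : R -> \bar R) :
  measurable_fun [set: R] f -> (forall x, 0 <= f x)%E ->
  (\int[mXY]_z f z = \int[mX]_x \int[mY]_y f (x * y)%R)%E.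
Proof.
move=> mf f0; rewrite ge0_integral_pushforward//=.
pose J (w : T) := (X w, Y w).
have mJ : measurable_fun setT J by exact: measurable_fun_pair.
pose g (z : R * R) := f (z.1 * z.2)%R.
have mg : measurable_fun setT g.
  by apply: (measurableT_comp mf); exact: measurable_fst_mul_snd.
rewrite -(fubini_tonelli1 (m1 := mX) (m2 := mY) g)//; last by move=> z; exact: f0.
transitivity (\int[pushforward P J]_z g z)%E.
  by rewrite [RHS](ge0_integral_pushforward mJ)// => z _; exact: f0.
apply: eq_measure_integral => A mA _; apply/esym.
by apply: product_measure_unique => // B C mB mC; exact: XY.
Qed.

(** Given Y = y, the identity for X is applied to the dilated function
    x |-> (H q)(x y); given X = x, the one for Y is applied to y |-> q(x y). *)
Lemma zero_biasM (k : nat) (c c' : R) : 0 <= c -> 0 <= c' ->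
  zero_bias mX k c -> zero_bias mY 1 c' -> zero_bias mXY k.+1 (c * c').
Proof.
move=> c0 c'0 biasX biasY q mq q0.
have mh := measurable_hardy mq q0.
have h0 y : (0 <= hardy q y)%E by exact: hardy_ge0.
have mih := measurable_iter_hardy k mh h0.
pose g z := ((z ^+ 2)%:E * iter k (@hardy R) (hardy q) z)%E.
have g0 z : (0 <= g z)%E by rewrite mule_ge0 ?iter_hardy_ge0// lee_fin sqr_ge0.
have mg : measurable_fun [set: R] g.
  by apply: emeasurable_funM => //; exact/measurable_EFinP/measurable_funX.
transitivity (\int[mXY]_z g z)%E.
  by apply: eq_integral => z _; rewrite iterSr.
have mM := @measurable_fst_mul_snd R.
have mgM := measurableT_comp mg mM.
have mhM := measurableT_comp mh mM.
have mqM := measurableT_comp mq mM.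
rewrite ge0_integral_distributionM//.
rewrite (fubini_tonelli (m1 := mX) (m2 := mY) _ mgM)//; last first.
  by move=> z; exact: g0.
have sq0 (y : R) : (0 <= (y ^+ 2)%:E)%E by rewrite lee_fin sqr_ge0.
have msq : measurable_fun [set: R] (fun y : R => (y ^+ 2)%:E).
  exact/measurable_EFinP/measurable_funX.
have scaleR (y : R) : measurable_fun [set: R] (fun x : R => x * y).
  exact: mulrr_measurable.
have scaleL (x : R) : measurable_fun [set: R] (fun y : R => x * y).
  exact: mulrl_measurable.
pose G (z : R * R) := ((z.2 ^+ 2)%:E * hardy q (z.1 * z.2)%R)%E.
have mG : measurable_fun [set: R * R] G.
  apply: emeasurable_funM => //.
  by apply: (measurableT_comp msq); exact: measurable_snd.
have G0 z : (0 <= G z)%E by rewrite mule_ge0.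
transitivity (\int[mY]_y (c%:E * \int[mX]_x G (x, y)))%E.
  apply: eq_integral => y _; rewrite /g /G/=.
  have mhy : measurable_fun [set: R] (fun x => hardy q (x * y)).
    exact: (measurableT_comp mh (scaleR y)).
  rewrite ge0_integralZl// muleCA -(biasX _ mhy)//.
  rewrite -ge0_integralZl//; last 2 first.
  - apply: emeasurable_funM => //; exact: measurable_iter_hardy.
  - by move=> x _; rewrite mule_ge0 ?iter_hardy_ge0.
  apply: eq_integral => x _; rewrite iter_hardy_scale muleA -EFinM.
  by rewrite exprMn mulrC.
have mGy : measurable_fun [set: R] (fun y => \int[mX]_x G (x, y))%E.
  exact: (@measurable_fun_fubini_tonelli_G _ _ _ _ _ mX G).
rewrite ge0_integralZl//; last by move=> y _; exact: integral_ge0.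
rewrite -(fubini_tonelli (m1 := mX) (m2 := mY) _ mG)//.
rewrite ge0_integral_distributionM// EFinM -muleA; congr (_ * _)%E.
rewrite -ge0_integralZl//; last 2 first.
- exact: (@measurable_fun_fubini_tonelli_F _ _ _ _ _ mY
    (q \o (fun z => z.1 * z.2)) mqM (fun z => q0 _)).
- by move=> x _; exact: integral_ge0.
apply: eq_integral => x _; rewrite /G/=.
have mqx : measurable_fun [set: R] (fun y => q (x * y)).
  exact: (measurableT_comp mq (scaleL x)).
rewrite -(biasY _ mqx)//; apply: eq_integral => y _ /=; congr (_ * _)%E.
by apply: eq_integral => u _; rewrite mulrCA.
Qed.

Definition symmetric_law (m : set R -> \bar R) : Prop := forall q : R -> \bar R,
  measurable_fun [set: R] q -> (forall x, 0 <= q x)%E ->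
  (\int[m]_z q (- z)%R = \int[m]_z q z)%E.

Lemma symmetric_lawM : symmetric_law mY -> symmetric_law mXY.
Proof.
move=> symY q mq q0.
have mqN : measurable_fun [set: R] (fun z => q (- z)).
  by apply: (measurableT_comp mq); exact: oppr_measurable.
rewrite !ge0_integral_distributionM//; apply: eq_integral => x _.
have mqx : measurable_fun [set: R] (fun y => q (x * y)).
  exact: (measurableT_comp mq (mulrl_measurable _)).
rewrite -(symY _ mqx)//; apply: eq_integral => y _.
by rewrite mulrN.
Qed.
End product_of_independent.

(** * Independence of a partial product from the remaining factors *)

Section independence.
Context d (T : measurableType d) (R : realType) (P : probability T R).

(** Restricted to [D], the joint law of (W, Y) is the product of the law of W and of
    P(D) times the law of Y, because both agree on rectangles; so is P(D) times
    the unrestricted joint law.  Comparing the two on {xy in C} gives the claim. *)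
Lemma indep_mul_of_event (W Y : {mfun T >-> R}) (D : set T) : measurable D ->
  (forall A B : set R, measurable A -> measurable B ->
    P (W @^-1` A `&` Y @^-1` B) = (P (W @^-1` A) * P (Y @^-1` B))%E) ->
  (forall A B : set R, measurable A -> measurable B ->
    P (W @^-1` A `&` Y @^-1` B `&` D) =
    (P (W @^-1` A) * (P (Y @^-1` B) * P D))%E) ->
  forall C : set R, measurable C ->
  P ((W * Y)%R @^-1` C `&` D) = (P ((W * Y)%R @^-1` C) * P D)%E.
Proof.
move=> mD indWY indWYD C mC.
pose J (w : T) := (W w, Y w).
have mJ : measurable_fun setT J by exact: measurable_fun_pair.
have r0 : 0 <= fine (P D) by rewrite fine_ge0.
pose r := NngNum r0.
have rE : (r%:num%:E = P D)%E by rewrite fineK// fin_num_measure.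
pose C' := (fun z : R * R => z.1 * z.2) @^-1` C.
have mC' : measurable C'.
  by rewrite -[C']setTI; apply: measurable_fst_mul_snd.
pose mu := (distribution P W \x mscale r (distribution P Y))%E.
have E1 : mu C' = pushforward (mrestr P mD) J C'.
  apply: product_measure_unique => // A B mA mB.
  transitivity (P (W @^-1` A) * (r%:num%:E * P (Y @^-1` B)))%E => //.
  by rewrite rE [(P D * _)%E]muleC; exact: indWYD.
have E2 : mu C' = mscale r (pushforward P J) C'.
  move=> ?; apply: product_measure_unique => // A B mA mB.
  transitivity (r%:num%:E * P (W @^-1` A `&` Y @^-1` B))%E => //.
  by rewrite indWY// muleCA.
transitivity (mu C'); first by rewrite E1.
by rewrite (E2 mJ) muleC -rE.
Qed.

Variables (n : nat) (X : 'I_n -> {RV P >-> R}).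
Hypothesis indX : mutually_independent X.

Definition partial_prod (k : nat) : {mfun T >-> R} :=
  \prod_(i < n | (i < k)%N) (X i : {mfun T >-> R}).

Lemma partial_prodE (k : nat) (w : T) :
  partial_prod k w = \prod_(i < n | (i < k)%N) X i w.
Proof. by rewrite /partial_prod; elim/big_rec2: _ => //= i y1 y2 _ <-. Qed.

Lemma partial_prodS (i : 'I_n) : partial_prod i.+1 = partial_prod i * X i.
Proof.
rewrite /partial_prod (bigD1 i)//= mulrC; congr (_ * _).
apply: eq_bigl => j; rewrite ltnS ltn_neqAle andbC; congr (_ && _).
Qed.

Definition joint_event (J : {set 'I_n}) (B : 'I_n -> set R) : set T :=
  \bigcap_(i in [set j | j \in J]) (X i @^-1` B i).

Lemma measurable_joint_event (J : {set 'I_n}) (B : 'I_n -> set R) :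
  (forall i, i \in J -> measurable (B i)) -> measurable (joint_event J B).
Proof.
move=> mB; apply: fin_bigcap_measurable => [|i /= iJ]; first exact: finite_finset.
by rewrite -[X in measurable X]setTI; apply: measurable_funP => //; exact: mB.
Qed.

Lemma joint_event_setU1 (i : 'I_n) (J : {set 'I_n}) (B : 'I_n -> set R)
    (B0 : set R) :
  i \notin J ->
  joint_event (i |: J) (fun j => if j == i then B0 else B j) =
  X i @^-1` B0 `&` joint_event J B.
Proof.
move=> iJ; apply/seteqP; split => [w Ew|w [Xw Ew] j /=].
  split; first by have := Ew i; rewrite /= !inE !eqxx; exact.
  move=> j /= jJ; have := Ew j; rewrite /= !inE jJ orbT => /(_ isT).
  by case: eqP => // ji; rewrite -ji jJ in iJ.
rewrite !inE => /orP[/eqP -> |jJ]; first by rewrite eqxx.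
by case: eqP => [-> //|_]; exact: Ew.
Qed.

Lemma joint_event_set1 (i : 'I_n) (B : set R) :
  joint_event [set i] (fun=> B) = X i @^-1` B.
Proof.
apply/seteqP; split => [w /(_ i)|w Xw j]/=; rewrite inE ?eqxx; first exact.
by move=> /eqP ->.
Qed.

Lemma indep_joint_event (i : 'I_n) (J : {set 'I_n}) (B : 'I_n -> set R)
    (B0 : set R) :
  i \notin J -> measurable B0 -> (forall j, j \in J -> measurable (B j)) ->
  P (X i @^-1` B0 `&` joint_event J B) =
  (P (X i @^-1` B0) * P (joint_event J B))%E.
Proof.
move=> iJ mB0 mB; rewrite -joint_event_setU1// /joint_event !indX//; last first.
  by move=> j; rewrite !inE; case: eqP => // _ /= jJ; exact: mB.
rewrite big_setU1//= eqxx; congr (_ * _)%E; apply: eq_bigr => j jJ.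
by case: eqP => // ji; rewrite -ji jJ in iJ.
Qed.

(** Mutual independence is a statement about boxes, whereas the partial product is
    a function of several coordinates.  Absorbing the factors one at a time with
    [indep_mul_of_event], while the later factors stay in the conditioning event,
    reduces it to the case of two variables. *)
Lemma partial_prod_indep (k : nat) (J : {set 'I_n}) (B : 'I_n -> set R)
    (A : set R) : (k <= n)%N ->
  (forall i, i \in J -> (k <= i)%N) ->
  (forall i, i \in J -> measurable (B i)) -> measurable A ->
  P (partial_prod k @^-1` A `&` joint_event J B) =
  (P (partial_prod k @^-1` A) * P (joint_event J B))%E.
Proof.
elim: k J B A => [|k IH] J B A kn kJ mB mA.
  have p1 w : partial_prod 0 w = 1 by rewrite partial_prodE big_pred0.
  have [A1|nA1] := pselect (A 1).
    rewrite (_ : _ @^-1` A = setT) ?setTI ?probability_setT ?mul1e//.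
    by apply/seteqP; split => // w _; rewrite /preimage/= p1.
  rewrite (_ : _ @^-1` A = set0) ?set0I ?measure0 ?mul0e//.
  by apply/seteqP; split => // w; rewrite /preimage/= p1.
pose i := Ordinal kn.
have iJ : i \notin J by apply/negP => /kJ; rewrite ltnn.
have kk : (k <= n)%N by exact: ltnW.
rewrite (partial_prodS i).
apply: indep_mul_of_event => //; first exact: measurable_joint_event.
  move=> A1 B1 mA1 mB1.
  by rewrite -joint_event_set1 IH// => j; rewrite inE => /eqP ->.
move=> A1 B1 mA1 mB1.
rewrite -setIA -indep_joint_event// -(joint_event_setU1 _ _ iJ) IH//.
  by move=> j; rewrite !inE => /orP[/eqP -> //|/kJ/ltnW].
by move=> j; rewrite !inE; case: eqP => // _ /= jJ; exact: mB.
Qed.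

Lemma partial_prod_indep1 (i : 'I_n) (A B : set R) :
  measurable A -> measurable B ->
  P (partial_prod i @^-1` A `&` X i @^-1` B) =
  (P (partial_prod i @^-1` A) * P (X i @^-1` B))%E.
Proof.
move=> mA mB.
have iN : (i <= n)%N by exact: ltnW.
by rewrite -joint_event_set1 partial_prod_indep// => j; rewrite inE => /eqP ->.
Qed.
End independence.

(** * The law of a product of independent centred normal variables *)

Lemma eq_zero_bias (R : realType) (m1 m2 : {measure set R -> \bar R}) (k : nat)
    (c : R) : (forall A, measurable A -> m1 A = m2 A) ->
  zero_bias m2 k c -> zero_bias m1 k c.
Proof.
move=> m12 bias q mq q0.
rewrite (eq_measure_integral m2) => [|A mA _]; last exact: m12.
by rewrite bias// [in RHS](eq_measure_integral m2) => [|A mA _]; rewrite ?m12.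
Qed.

Lemma eq_symmetric_law (R : realType) (m1 m2 : {measure set R -> \bar R}) :
  (forall A, measurable A -> m1 A = m2 A) -> symmetric_law m2 -> symmetric_law m1.
Proof.
move=> m12 sym q mq q0.
rewrite (eq_measure_integral m2) => [|A mA _]; last exact: m12.
by rewrite sym// [in RHS](eq_measure_integral m2) => [|A mA _]; rewrite ?m12.
Qed.

Lemma normal_symmetric_law (R : realType) (s : R) : s != 0 ->
  symmetric_law (normal_prob 0 s).
Proof.
move=> s0 q mq q0.
have mqN : measurable_fun [set: R] (fun z => q (- z)).
  by apply: (measurableT_comp mq); exact: oppr_measurable.
rewrite !ge0_integral_normal//.
have mg : measurable_fun [set: R] (fun x => q x * (normal_pdf 0 s x)%:E)%E.
  apply: emeasurable_funM => //; apply/measurable_EFinP.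
  exact: measurable_normal_pdf.
have g0 x : (0 <= q x * (normal_pdf 0 s x)%:E)%E.
  by rewrite mule_ge0// lee_fin normal_pdf_ge0.
have N10 : -1 != 0 :> R by rewrite oppr_eq0 oner_eq0.
have := ge0_integral_scale N10 mg g0; rewrite normrN1 invr1 mul1e => <-.
by apply: eq_integral => x _; rewrite mulN1r normal_pdfN.
Qed.

Section product_normal_law.
Context d (T : measurableType d) (R : realType) (P : probability T R).
Variables (n : nat) (X : 'I_n -> {RV P >-> R}) (s : 'I_n -> R).
Hypothesis indX : mutually_independent X.
Hypothesis s_gt0 : forall i, 0 < s i.
Hypothesis lawX : forall i (B : set R), measurable B ->
  distribution P (X i) B = normal_prob 0 (s i) B.

Let s0 i : s i != 0. Proof. by rewrite gt_eqF. Qed.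

Lemma zero_bias_factor (i : 'I_n) : zero_bias (distribution P (X i)) 1 (s i ^+ 2).
Proof.
apply: (eq_zero_bias (m2 := pushforward (normal_prob 0 (s i))
  (id : measurableTypeR R -> R))) => [A mA|]; first exact: lawX.
exact: normal_zero_bias.
Qed.

Lemma symmetric_law_factor (i : 'I_n) : symmetric_law (distribution P (X i)).
Proof.
apply: (eq_symmetric_law (m2 := pushforward (normal_prob 0 (s i))
  (id : measurableTypeR R -> R))) => [A mA|]; first exact: lawX.
exact: normal_symmetric_law.
Qed.

(** The empty product is the constant 1, for which the identity with k = 0 and c = 1
    is trivial. *)
Lemma zero_bias_partial_prod (k : nat) : (k <= n)%N ->
  zero_bias (distribution P (partial_prod X k)) k
    (\prod_(i < n | (i < k)%N) s i ^+ 2).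
Proof.
elim: k => [|k IH] kn.
  move=> q mq q0 /=; rewrite big_pred0// mul1e.
  have mzq : measurable_fun [set: R] (fun z => (z ^+ 2)%:E * q z)%E.
    by apply: emeasurable_funM => //; exact/measurable_EFinP/measurable_funX.
  rewrite !ge0_integral_distribution//; last first.
    by move=> z; rewrite mule_ge0// lee_fin sqr_ge0.
  apply: eq_integral => w _ /=.
  by rewrite partial_prodE big_pred0// expr1n mul1e.
rewrite (partial_prodS X (Ordinal kn)).
rewrite (bigD1 (Ordinal kn))//= [X in zero_bias _ _ X]mulrC.
rewrite (eq_bigl (fun i : 'I_n => (i < k)%N)); last first.
  by move=> j; rewrite ltnS ltn_neqAle andbC.
apply: zero_biasM => //.
- exact: (partial_prod_indep1 indX (Ordinal kn)).
- by apply: prodr_ge0 => i _; exact: sqr_ge0.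
- exact: sqr_ge0.
- exact/IH/ltnW.
- exact: zero_bias_factor.
Qed.

(** One symmetric factor is enough to make a product of independent variables
    symmetric. *)
Lemma symmetric_law_partial_prod (k : nat) : (0 < k <= n)%N ->
  symmetric_law (distribution P (partial_prod X k)).
Proof.
case: k => [//|k /= kn]; rewrite (partial_prodS X (Ordinal kn)).
apply: symmetric_lawM; last exact: symmetric_law_factor.
exact: (partial_prod_indep1 indX (Ordinal kn)).
Qed.
End product_normal_law.

Lemma product_normal_bias (R : realType) (n : nat) (sigma : R)
    (m : {measure set R -> \bar R}) : (0 < n)%N -> product_normal n sigma m ->
  zero_bias m n (sigma ^+ 2) /\ symmetric_law m.
Proof.
move=> n0 [d [T [P [X [s [indX s_gt0 lawX -> mE]]]]]].
have mE' A : measurable A -> m A = distribution P (partial_prod X n) A.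
  move=> mA; rewrite mE//; congr (P (_ @^-1` A)); apply/funext => w.
  rewrite partial_prodE; apply: eq_bigl => i.
  by rewrite ltn_ord.
split.
  apply: (eq_zero_bias mE').
  rewrite -prodrXl (eq_bigl (fun i : 'I_n => (i < n)%N)).
    exact: zero_bias_partial_prod.
  by move=> i; rewrite ltn_ord.
apply: (eq_symmetric_law mE'); apply: (symmetric_law_partial_prod indX s_gt0 lawX).
by rewrite n0 leqnn.
Qed.

(** * The operators T and A in terms of derivatives *)

Fixpoint stirling2 (m k : nat) : nat :=
  match m, k with
  | 0, 0 => 1
  | 0, _.+1 => 0
  | _.+1, 0 => 0
  | m'.+1, k'.+1 => (k * stirling2 m' k + stirling2 m' k')%N
  end.

Lemma stirling2_small (m k : nat) : (m < k)%N -> stirling2 m k = 0%N.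
Proof.
by elim: m k => [|m IH] [|k]//= mk; rewrite !IH ?muln0// (leq_trans _ mk).
Qed.

Section iterated_T_op.
Variables (R : realType) (n : nat) (f : R -> R).
Hypothesis Cf : Cn n f.
Local Notation df k := (derive1n k f).

Lemma is_derive_derive1n (k : nat) (x : R) : (k < n)%N ->
  is_derive x 1 (df k) (df k.+1 x).
Proof.
move=> kn; have dk := Cf.1 k x kn.
by apply: DeriveDef => //; rewrite derive1nS derive1E.
Qed.

Lemma continuous_derive1n (k : nat) : (k <= n)%N -> continuous (df k).
Proof.
rewrite leq_eqVlt => /orP[/eqP ->|kn x]; first exact: Cf.2.
by apply: differentiable_continuous; apply/derivable1_diffP; exact: Cf.1.
Qed.

(** Differentiating x^k f^(k) produces k x^(k-1) f^(k) + x^k f^(k+1); collecting the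
    terms in f^(k+1) is the recurrence of the Stirling numbers. *)
Lemma is_derive_stirling_sum (m : nat) (x : R) : (m < n)%N ->
  is_derive x 1
    (fun x => \sum_(k < m.+1) (stirling2 m k)%:R * (x ^+ k * df k x))
    (\sum_(k < m.+1) (stirling2 m.+1 k.+1)%:R * (x ^+ k * df k.+1 x)).
Proof.
move=> mn.
pose h (k : 'I_m.+1) (x : R) : R := (stirling2 m k)%:R * (x ^+ k * df k x).
have -> : (fun x => \sum_(k < m.+1) (stirling2 m k)%:R * (x ^+ k * df k x)) =
    \sum_(k < m.+1) h k by apply/funext => y; rewrite fct_sumE.
(* a k and b k are the two terms of the derivative of the k-th summand; the sum of
   the a k is shifted by one index, a 0 and a m.+1 being zero. *)
pose a (k : nat) : R := k%:R * (stirling2 m k)%:R * (x ^+ k.-1 * df k x).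
pose b (k : nat) : R := (stirling2 m k)%:R * (x ^+ k * df k.+1 x).
have dh (k : 'I_m.+1) : is_derive x 1 (h k) (a k + b k).
  have kn : (k < n)%N by apply: leq_trans mn; rewrite ltnS -ltnS.
  have d1 := is_derive_derive1n x kn.
  have d2 : is_derive x 1 (fun x : R => x ^+ k) (k%:R * x ^+ k.-1).
    have := is_deriveX k (is_derive_id x (1 : R)).
    by rewrite exprfctE scaler1.
  apply: is_derive_eq.
  rewrite -[LHS]/((stirling2 m k)%:R *
    (x ^+ k * df k.+1 x + df k x * (k%:R * x ^+ k.-1))) /a /b.
  move: (x ^+ k.-1) => y; ring.
have := is_derive_sum dh; congr (is_derive _ _ _ _).
rewrite big_split/= [RHS](eq_bigr (fun k : 'I_m.+1 => a k.+1 + b k)); last first.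
  by move=> k _; rewrite /a /b /= natrD natrM mulrDl.
rewrite big_split/=; congr (_ + _).
rewrite big_ord_recl/= {1}/a !mul0r add0r.
rewrite [RHS]big_ord_recr/= [X in _ = _ + X]/a stirling2_small// mulr0 mul0r.
by rewrite addr0.
Qed.

Lemma iter_T_opE (m : nat) : (m <= n)%N -> iter m (@T_op R) f =
  fun x => \sum_(k < m.+1) (stirling2 m k)%:R * (x ^+ k * df k x).
Proof.
elim: m => [|m IH] mn; apply/funext => x.
  by rewrite big_ord1 /= expr0 !mul1r.
rewrite iterS IH ?(ltnW mn)// /T_op derive1E.
have d := is_derive_stirling_sum x mn.
rewrite derive_val mulr_sumr [RHS]big_ord_recl/= mul0r add0r.
by apply: eq_bigr => k _; rewrite mulrCA [x * (_ * _)]mulrA -exprS.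
Qed.

Lemma is_derive_iter_T_op (m : nat) (x : R) : (m < n)%N ->
  is_derive x 1 (iter m (@T_op R) f) (A_op m.+1 f x).
Proof.
move=> mn; rewrite /A_op /= iter_T_opE ?(ltnW mn)//.
have d := is_derive_stirling_sum x mn.
by rewrite derive1E derive_val.
Qed.

Lemma A_opE (m : nat) : (m < n)%N -> A_op m.+1 f =
  fun x => \sum_(k < m.+1) (stirling2 m.+1 k.+1)%:R * (x ^+ k * df k.+1 x).
Proof.
move=> mn; apply/funext => x; rewrite /A_op /= iter_T_opE ?(ltnW mn)// derive1E.
by have d := is_derive_stirling_sum x mn; rewrite derive_val.
Qed.

Lemma continuous_A_op (m : nat) : (m < n)%N -> continuous (A_op m.+1 f).
Proof.
move=> mn; rewrite A_opE//.
have : forall j, (j <= m.+1)%N -> continuous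
    (fun x : R => \sum_(k < j) (stirling2 m.+1 k.+1)%:R * (x ^+ k * df k.+1 x)).
  elim=> [|j IH] jm x.
    under eq_fun do rewrite big_ord0.
    exact: cvg_cst.
  under eq_fun do rewrite big_ord_recr/=.
  apply: cvgD; first exact: (IH (ltnW jm)).
  apply: cvgM; first exact: cvg_cst.
  apply: cvgM; first exact: exprn_continuous.
  exact: (@continuous_derive1n j.+1 (leq_trans jm mn)).
by apply.
Qed.

End iterated_T_op.

(** * The averaging operator undoes the operators A *)

(** Bounded above on bounded sets.  For nonnegative functions this property is kept
    by [hardy] and makes the iterated averages finite, hence subtractable. *)
Definition locally_bounded (R : realType) (q : R -> \bar R) : Prop :=
  forall M : R, exists C : R, forall z, `|z| <= M -> (q z <= C%:E)%E.

Section hardy_calculus.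
Context (R : realType).
Local Notation leb := (@lebesgue_measure R).

Lemma measurable_hardy_integrand (q : R -> \bar R) (y : R) (D : set R) :
  measurable_fun [set: R] q -> measurable_fun D (fun u : R => q (u * y)).
Proof.
move=> mq; apply: measurable_funTS.
exact: (measurableT_comp mq (mulrr_measurable _)).
Qed.

Lemma locally_bounded_hardy (q : R -> \bar R) : measurable_fun [set: R] q ->
  (forall x, 0 <= q x)%E -> locally_bounded q -> locally_bounded (hardy q).
Proof.
move=> mq q0 bq M; have [C HC] := bq M; exists C => y yM.
apply: (@le_trans _ _ (\int[leb]_(u in `]0%R, 1%R]) (cst C%:E) u)%E).
  apply: ge0_le_integral => //.
  - exact: measurable_hardy_integrand.
  - move=> u; rewrite /= in_itv/= => /andP[u0 u1]; apply: HC.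
    rewrite normrM (le_trans _ yM)// ler_piMl// ger0_norm// ltW//.
rewrite integral_cst//= lebesgue_measure_itv/= lte_fin ltr01.
by rewrite -EFinB subr0 mule1.
Qed.

Lemma locally_bounded_iter_hardy (k : nat) (q : R -> \bar R) :
  measurable_fun [set: R] q -> (forall x, 0 <= q x)%E ->
  locally_bounded q -> locally_bounded (iter k (@hardy R) q).
Proof.
move=> mq q0 bq; elim: k => [//|k IH] /=; apply: locally_bounded_hardy => //.
  exact: measurable_iter_hardy.
by move=> x; exact: iter_hardy_ge0.
Qed.

Lemma locally_bounded_fin_num (q : R -> \bar R) (y : R) :
  (forall x, 0 <= q x)%E -> locally_bounded q -> q y \is a fin_num.
Proof.
move=> q0 bq; have [C HC] := bq `|y|.
by rewrite ge0_fin_numE// (le_lt_trans (HC _ (lexx _)))// ltry.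
Qed.

(** The fundamental theorem of calculus for u |-> g (u * y). *)
Lemma integral_scaled_derivative (g dg : R -> R) (y : R) :
  (forall x : R, is_derive x (1 : R) g (dg x)) -> continuous dg ->
  (\int[leb]_(u in `]0%R, 1%R]) (y * dg (u * y))%:E = (g y - g 0)%:E)%E.
Proof.
move=> dgE cdg.
have cG : continuous (fun u : R => y * dg (u * y)).
  move=> u; apply: cvgM; first exact: cvg_cst.
  apply: (continuous_comp (f := fun u : R => u * y)); last exact: cdg.
  by apply: cvgM; [exact: cvg_id|exact: cvg_cst].
have dG (u : R) : is_derive u 1 (fun u : R => g (u * y)) (y * dg (u * y)).
  have d1 : is_derive u 1 (fun u : R => u * y) y.
    apply: is_derive_eq.
    by rewrite scaler0 add0r -[LHS]/(y * 1) mulr1.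
  rewrite mulrC.
  exact: (@is_derive1_comp _ g (fun u : R => u * y) u _ _ (dgE (u * y)) d1).
have cF (u : R) : {for u, continuous (fun u : R => g (u * y))}.
  by apply: differentiable_continuous; apply/derivable1_diffP; have [] := dG u.
rewrite integral_itv_obnd_cbnd; last first.
  by apply: measurable_funTS; apply/measurable_EFinP; exact: continuous_measurable_fun.
rewrite (continuous_FTC2 (F := fun u => g (u * y)))//.
- by rewrite mul1r mul0r EFinB.
- exact: continuous_subspaceT.
- split.
  + by move=> u _; have [] := dG u.
  + by apply: cvg_at_right_filter; exact: cF.
  + by apply: cvg_at_left_filter; exact: cF.
- by move=> u _; rewrite derive1E; have d := dG u; rewrite derive_val.
Qed.

(** [p] and [q] stand for iterated averages of the positive and negative parts of a
    function, whose difference is only known to be [dg] away from 0; this is enough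
    as the average at [y != 0] sees only the points [u * y] with [u > 0]. *)
Lemma hardyB (p q : R -> \bar R) (g dg : R -> R) (y : R) : y != 0 ->
  measurable_fun [set: R] p -> (forall x, 0 <= p x)%E -> locally_bounded p ->
  measurable_fun [set: R] q -> (forall x, 0 <= q x)%E -> locally_bounded q ->
  (forall x : R, is_derive x (1 : R) g (dg x)) -> continuous dg ->
  (forall x : R, x != 0 -> (p x - q x)%E = (dg x)%:E) ->
  (hardy p y - hardy q y = ((g y - g 0) / y)%:E)%E.
Proof.
move=> y0 mp p0 bp mq q0 bq dgE cdg pq.
have int h : measurable_fun [set: R] h -> (forall x, 0 <= h x)%E ->
    locally_bounded h ->
    leb.-integrable `]0%R, 1%R] (fun u => h (u * y)).
  move=> mh h0 bh; apply/integrableP; split.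
    exact: measurable_hardy_integrand.
  under eq_integral do rewrite gee0_abs//.
  have := locally_bounded_fin_num y (fun x => hardy_ge0 x h0)
    (locally_bounded_hardy mh h0 bh).
  by rewrite ge0_fin_numE// hardy_ge0.
have ip := int p mp p0 bp; have iq := int q mq q0 bq.
rewrite /hardy -integralB//.
have E : ((g y - g 0)%:E =
    y%:E * \int[leb]_(u in `]0%R, 1%R]) (p (u * y)%R - q (u * y)%R))%E.
  rewrite -integralZl//; last exact: integrableB.
  rewrite -integral_scaled_derivative//; apply: eq_integral => u.
  rewrite inE/= in_itv/= => /andP[u0 _].
  by rewrite EFinM -pq// mulf_neq0// gt_eqF.
rewrite mulrC EFinM E muleA -EFinM mulVf// mul1e//.
Qed.

End hardy_calculus.

Lemma locally_bounded_continuous (R : realType) (A : R -> R) (q : R -> \bar R) :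
  continuous A -> (forall x, q x <= `|A x|%:E)%E -> locally_bounded q.
Proof.
move=> cA qA M.
have cN : {within `[- `|M|, `|M|], continuous (fun x => `|A x|)}.
  apply: continuous_subspaceT => x; apply: (continuous_comp (cA x)).
  exact: norm_continuous.
have MM : - `|M| <= `|M| by rewrite (le_trans _ (normr_ge0 M))// oppr_le0.
have [c _ cmax] := EVT_max MM cN.
exists `|A c| => z zM; apply: (le_trans (qA z)); rewrite lee_fin cmax//.
rewrite in_itv/= -ler_norml; exact: le_trans (ler_norm M).
Qed.

Section iterated_hardy_A_op.
Variables (R : realType) (m : nat) (f : R -> R).
Hypothesis Cf : Cn m.+1 f.
Local Notation A := (EFin \o A_op m.+1 f).
Local Notation Apos := (A^\+)%E.
Local Notation Aneg := (A^\-)%E.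

Lemma continuous_A_op_last : continuous (A_op m.+1 f).
Proof. exact: (continuous_A_op Cf). Qed.

Lemma measurable_A_op : measurable_fun [set: R] A.
Proof.
by apply/measurable_EFinP; apply: continuous_measurable_fun; exact: continuous_A_op_last.
Qed.

Let mp : measurable_fun [set: R] Apos.
Proof. by apply: measurable_funepos; exact: measurable_A_op. Qed.

Let mq : measurable_fun [set: R] Aneg.
Proof. by apply: measurable_funeneg; exact: measurable_A_op. Qed.

Let p0 x : (0 <= Apos x)%E. Proof. exact: funepos_ge0. Qed.
Let q0 x : (0 <= Aneg x)%E. Proof. exact: funeneg_ge0. Qed.

Let bp : locally_bounded Apos.
Proof.
apply: (locally_bounded_continuous continuous_A_op_last) => x.
by rewrite -abse_EFin -[X in (_ <= X)%E]/((abse \o A) x) fune_abse leeDl.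
Qed.

Let bq : locally_bounded Aneg.
Proof.
apply: (locally_bounded_continuous continuous_A_op_last) => x.
by rewrite -abse_EFin -[X in (_ <= X)%E]/((abse \o A) x) fune_abse leeDr.
Qed.

Let mip k : measurable_fun [set: R] (iter k (@hardy R) Apos).
Proof. exact: measurable_iter_hardy. Qed.
Let miq k : measurable_fun [set: R] (iter k (@hardy R) Aneg).
Proof. exact: measurable_iter_hardy. Qed.
Let ip0 k x : (0 <= iter k (@hardy R) Apos x)%E.
Proof. exact: iter_hardy_ge0. Qed.
Let iq0 k x : (0 <= iter k (@hardy R) Aneg x)%E.
Proof. exact: iter_hardy_ge0. Qed.
Let bip k : locally_bounded (iter k (@hardy R) Apos).
Proof. exact: locally_bounded_iter_hardy. Qed.
Let biq k : locally_bounded (iter k (@hardy R) Aneg).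
Proof. exact: locally_bounded_iter_hardy. Qed.

(** Each average lowers the index of A by one: [A_op j.+2 f] is the derivative of
    T^(j+1) f = x A_(j+1) f, which vanishes at 0. *)
Lemma iter_hardy_A_op (k : nat) (y : R) : (k <= m)%N -> y != 0 ->
  (iter k (@hardy R) Apos y - iter k (@hardy R) Aneg y =
   (A_op (m - k).+1 f y)%:E)%E.
Proof.
elim: k y => [|k IH] y km y0.
  rewrite subn0 -[RHS]/(A y) [in RHS](funeposneg A)//.
have mk : (m - k < m.+1)%N by rewrite ltnS leq_subr.
have dT (x : R) : is_derive x 1 (iter (m - k) (@T_op R) f) (A_op (m - k).+1 f x).
  exact: (is_derive_iter_T_op Cf).
rewrite !iterS (hardyB y0 (mip k) (ip0 k) (bip k) (miq k) (iq0 k) (biq k) dT).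
- rewrite (_ : m - k = (m - k.+1).+1)%N; last by rewrite subnSK.
  by rewrite iterS /T_op mul0r subr0 mulrC mulKf.
- exact: (continuous_A_op Cf).
- by move=> x x0; apply: IH => //; exact: ltnW.
Qed.

Lemma sqr_iter_hardy_A_op (z : R) :
  ((z ^+ 2)%:E * iter m.+1 (@hardy R) Apos z -
   (z ^+ 2)%:E * iter m.+1 (@hardy R) Aneg z = (z * (f z - f 0))%:E)%E.
Proof.
have [->|z0] := eqVneq z 0.
  by rewrite expr0n/= !mul0e sube0 mul0r.
rewrite -muleBr//; last first.
  rewrite fin_num_adde_defr//; apply: locally_bounded_fin_num.
    by move=> x; exact: iter_hardy_ge0.
  exact: locally_bounded_iter_hardy.
have dT (x : R) : is_derive x 1 f (A_op 1 f x).
  exact: (is_derive_iter_T_op Cf (m := 0)).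
rewrite !iterS (hardyB z0 (mip m) (ip0 m) (bip m) (miq m) (iq0 m) (biq m) dT).
- by rewrite -EFinM; congr (_%:E); field.
- exact: (continuous_A_op Cf (m := 0)).
- by move=> x x0; rewrite iter_hardy_A_op// subnn.
Qed.

End iterated_hardy_A_op.

(** * The Stein identity *)

Lemma iter_hardy_cst1 (R : realType) (k : nat) (z : R) :
  iter k (@hardy R) (cst 1%E) z = 1%E.
Proof.
elim: k z => [//|k IH] z /=; rewrite /hardy.
under eq_integral do rewrite IH.
by rewrite integral_cst//= lebesgue_measure_itv/= lte_fin ltr01 -EFinB subr0 mule1.
Qed.

Section centred_law.
Context (R : realType) (mu : probability R R) (k : nat) (c : R).
Hypothesis bias : zero_bias mu k c.
Hypothesis sym : symmetric_law mu.

(** The identity for the constant function 1, which averaging leaves unchanged. *)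
Lemma zero_bias_second_moment : (\int[mu]_z (z ^+ 2)%:E = c%:E)%E.
Proof.
have := bias (measurable_cst 1%E) (fun _ => lee01).
rewrite integral_cst//= probability_setT !mule1 => <-.
by apply: eq_integral => z _; rewrite iter_hardy_cst1 mule1.
Qed.

Lemma integrable_centred : mu.-integrable setT (EFin : R -> \bar R).
Proof.
apply/integrableP; split; first exact/measurable_EFinP.
apply: (@le_lt_trans _ _ (\int[mu]_z (1 + (z ^+ 2)%:E))%E).
  apply: ge0_le_integral => //.
  - by apply: measurableT_comp => //; exact/measurable_EFinP.
  - apply: emeasurable_funD => //.
    exact/measurable_EFinP/measurable_funX.
  - move=> z _; rewrite abse_EFin -EFinD lee_fin.
    have [z1|z1] := leP `|z| 1; first by rewrite (le_trans z1)// lerDl sqr_ge0.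
    rewrite -real_normK ?num_real// (@le_trans _ _ (`|z| ^+ 2))//; last first.
      by rewrite lerDr.
    by rewrite expr2 ler_peMl// ltW.
rewrite ge0_integralD//; last 2 first.
- by move=> z _; rewrite lee_fin sqr_ge0.
- exact/measurable_EFinP/measurable_funX.
rewrite integral_cst//= probability_setT zero_bias_second_moment.
by rewrite mule1 -EFinD ltry.
Qed.

Lemma integral_centred : (\int[mu]_z z%:E = 0)%E.
Proof.
have mE : measurable_fun [set: R] (EFin : R -> \bar R) by exact/measurable_EFinP.
rewrite integralE.
have -> : (\int[mu]_z (EFin^\- z) = \int[mu]_z (EFin^\+ z))%E.
  rewrite -(sym (measurable_funepos mE)); last by move=> z; exact: funepos_ge0.
  apply: eq_integral => z _.
  by rewrite funeposE funenegE.
rewrite subee// integrable_pos_fin_num//; exact: integrable_centred.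
Qed.
End centred_law.

(** The identity of [zero_bias] for the two parts of A f gives the expectation of
    z (f z - f 0), and the centring of [mu] removes the constant [f 0]. *)
Lemma stein_identity (R : realType) (mu : probability R R) (m : nat) (c : R)
    (f : R -> R) : Cn m.+1 f ->
  zero_bias mu m.+1 c -> symmetric_law mu ->
  mu.-integrable setT (EFin \o A_op m.+1 f) ->
  mu.-integrable setT (fun z => (z * f z)%:E) /\
  (\int[mu]_z (z * f z)%:E = c%:E * \int[mu]_z (A_op m.+1 f z)%:E)%E.
Proof.
move=> Cf bias sym iA; set A := EFin \o A_op m.+1 f in iA *.
have mA := measurable_A_op Cf.
have side (q : R -> \bar R) : measurable_fun [set: R] q ->
    (forall x, 0 <= q x)%E -> mu.-integrable setT q ->
    mu.-integrable setT (fun z => (z ^+ 2)%:E * iter m.+1 (@hardy R) q z)%E.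
  move=> mq q0 iq; apply/integrableP; split.
    apply: emeasurable_funM; last exact: measurable_iter_hardy.
    exact/measurable_EFinP/measurable_funX.
  under eq_integral.
    move=> z _; rewrite gee0_abs; last first.
      by rewrite mule_ge0 ?iter_hardy_ge0// lee_fin sqr_ge0.
    over.
  rewrite bias//.
  have : (\int[mu]_z q z)%E \is a fin_num by exact: integrable_fin_num.
  by move=> /fineK <-; rewrite -EFinM ltry.
have mp : measurable_fun [set: R] (A^\+)%E by exact: measurable_funepos.
have mn : measurable_fun [set: R] (A^\-)%E by exact: measurable_funeneg.
have ip := integrable_funepos measurableT iA.
have iN := integrable_funeneg measurableT iA.
have Ip := side _ mp (fun x => funepos_ge0 _ x) ip.
have In := side _ mn (fun x => funeneg_ge0 _ x) iN.
have E0 : (fun z => (z * (f z - f 0))%:E) =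
    (fun z => (z ^+ 2)%:E * iter m.+1 (@hardy R) (A^\+)%E z -
              (z ^+ 2)%:E * iter m.+1 (@hardy R) (A^\-)%E z)%E.
  by apply/funext => z; rewrite -(sqr_iter_hardy_A_op Cf).
have I0 : mu.-integrable setT (fun z => (z * (f z - f 0))%:E).
  by rewrite E0; exact: integrableB.
have iz := integrableZl measurableT (f 0) (integrable_centred bias).
have E1 : (fun z : R => (z * f z)%:E) =
    (fun z => (z * (f z - f 0))%:E + (f 0)%:E * z%:E)%E.
  by apply/funext => z; rewrite -EFinM -EFinD; congr (_%:E); ring.
split; first by rewrite E1; exact: integrableD.
rewrite E1 integralD// integralZl//; last exact: integrable_centred bias.
rewrite (integral_centred bias sym) mule0 adde0 E0 integralB//.
rewrite (bias _ mp)// (bias _ mn)//.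
have -> : (\int[mu]_z (A_op m.+1 f z)%:E =
    \int[mu]_z A^\+ z - \int[mu]_z A^\- z)%E by exact: integralE.
rewrite [RHS]muleBr// fin_num_adde_defr//.
exact: (integrable_pos_fin_num measurableT iA).
Qed.

Theorem proposition2p3 (R : realType) (d : measure_display)
    (Omega : measurableType d) (P : probability Omega R)
    (n : nat) (hn : (1 <= n)%N) (sigma : R) (hsigma : 0 < sigma)
    (Z : {RV P >-> R}) (hZ : product_normal n sigma (distribution P Z))
    (f : R -> R) (hf : Cn n f)
    (hZf : ('E_P[fun w => `|Z w * f (Z w)|%R] < +oo)%E)
    (hZfk : forall k : nat, (1 <= k <= n)%N ->
      ('E_P[fun w => `|Z w ^+ k.-1 * derive1n k f (Z w)|%R] < +oo)%E) :
  ('E_P[fun w => (sigma ^+ 2 * A_op n f (Z w) - Z w * f (Z w))%R] = 0)%E.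
Proof.
have [bias sym] := product_normal_bias hn hZ.
case: n hn hZ hf hZfk bias => [//|m] _ _ Cf hZfk bias.
have mZ : measurable_fun setT Z by exact: measurable_funP.
pose g k (z : R) : R := z ^+ k * derive1n k.+1 f z.
have mg k : (k < m.+1)%N -> measurable_fun [set: R] (g k).
  move=> km; apply: measurable_funM; first exact: measurable_funX.
  by apply: continuous_measurable_fun; exact: (continuous_derive1n Cf).
have ig (k : 'I_m.+1) : P.-integrable setT (fun w => (g k (Z w))%:E).
  apply/integrableP; split.
    apply/measurable_EFinP; apply: (measurableT_comp _ mZ).
    exact: mg.
  have := hZfk k.+1; rewrite unlock; apply.
  by rewrite /= ltn_ord.
have iAZ : P.-integrable setT (fun w => (A_op m.+1 f (Z w))%:E).
  rewrite (_ : (fun w => _) =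
      (fun w => \sum_(k < m.+1) ((stirling2 m.+1 k.+1)%:R%:E * (g k (Z w))%:E))%E).
    by apply: integrable_sum => // k _; exact: integrableZl.
  by apply/funext => w; rewrite (A_opE Cf)// sumEFin.
have mA := measurable_A_op Cf.
have iA : (distribution P Z).-integrable setT (EFin \o A_op m.+1 f).
  exact: integrable_pushforward.
have [izf zfE] := stein_identity Cf bias sym iA.
have mzf : measurable_fun [set: R] (fun z => (z * f z)%:E).
  exact: (measurable_int _ izf).
have izfZ : P.-integrable setT (fun w => (Z w * f (Z w))%:E).
  apply/integrableP; split; first exact: (measurableT_comp mzf mZ).
  have /integrableP[_] := izf.
  by rewrite ge0_integral_distribution//; exact: measurableT_comp.
rewrite unlock.
under eq_integral do rewrite EFinB EFinM.
rewrite integralB//; last exact: integrableZl.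
rewrite integralZl//.
have <- : (\int[distribution P Z]_z (A_op m.+1 f z)%:E =
    \int[P]_w (A_op m.+1 f (Z w))%:E)%E.
  exact: integral_distribution.
have <- : (\int[distribution P Z]_z (z * f z)%:E =
    \int[P]_w (Z w * f (Z w))%:E)%E.
  exact: integral_distribution.
rewrite zfE subee// fin_numM//; exact: integrable_fin_num iA.
Qed.
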